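(* Let $k\geqslant 2$ be an integer and let $K(z)=\sum_{n\geqslant 0}\kappa(n)z^n$ with $\kappa$ as defined in the context. Then the functions $K(z)$ and $K(z^k)$ are algebraically independent over $\mathbb{C}(z)$.
   Context: Fix an integer $k\geqslant 2$. For $i\in\{0,1,\ldots,k-1\}$ let $\mathbf{A}_i=\begin{pmatrix} i+1&1\\ 1&0\end{pmatrix}$. For an integer $n\geqslant 0$ with standard base-$k$ expansion $(n)_k=i_s\cdots i_1i_0$ (no leading zeros; the empty word for $n=0$), define $\kappa(n)=[1\ 0]\,\mathbf{A}_{i_0}\mathbf{A}_{i_1}\cdots\mathbf{A}_{i_s}\,[1\ 0]^T$, the empty product being the identity matrix. $K(z)$ is analytic in the open unit disc. *)

(* Defs.v *)
From mathcomp Require Export all_boot all_order all_algebra.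
From mathcomp Require Export fraction complex.
From mathcomp Require Export boolp classical_sets reals topology normedtype
  sequences exp.
(* The notations of mpoly clash with those of the analysis library. *)
From mathcomp Require Export -(notations) mpoly.

Set Implicit Arguments.
Unset Strict Implicit.
Unset Printing Implicit Defensive.

Export Order.TTheory GRing.Theory Num.Theory.
Export numFieldNormedType.Exports.

Local Open Scope classical_set_scope.
Local Open Scope ring_scope.

(* The standard base-k expansion of n, least significant digit first:
   [:: i_0; ...; i_s].  For k >= 2, up_log k n.+1 is the least e such that
   n < k ^ e, that is, the number of digits of n (0 when n = 0). *)
Definition digits (k n : nat) : seq nat :=
  mkseq (fun j => (n %/ k ^ j %% k)%N) (up_log k n.+1).

(* The matrix ((i + 1, 1), (1, 0)). *)
Definition digit_mx (i : nat) : 'M[nat]_2 :=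
  \matrix_(r < 2, c < 2)
    if (r == 0) && (c == 0) then i.+1
    else if (r == 1) && (c == 1) then 0%N else 1%N.

Definition kappa (k n : nat) : nat :=
  let e0 : 'rV[nat]_2 := delta_mx 0 0 in
  (e0 *m (\prod_(i <- digits k n) digit_mx i) *m e0^T) 0 0.

(* R[i]^o is R[i] with the topology of the complex modulus. *)
Definition K (R : realType) (k : nat) (z : R[i]) : R[i] :=
  lim (series (fun n => (kappa k n)%:R * z ^+ n : R[i]^o) @ \oo).

Arguments K : clear implicits.

Definition unit_disc (R : realType) : set R[i] := [set z | `|z| < 1].
Arguments unit_disc : clear implicits.

(* The field of rational functions C(z). *)
Notation ratfun C := {fraction {poly C}}.

(* g has value w at z, in particular z is not a pole of g.  The chosen
   representative of a class in the fraction field need not be in lowest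
   terms, whence the existential quantifier. *)
Definition has_value (C : fieldType) (g : ratfun C) (z w : C) : Prop :=
  exists p q : {poly C},
    [/\ q.[z] != 0, g = tofrac p / tofrac q & w = p.[z] / q.[z]].

Definition regular_at (C : fieldType) (z : C) (g : ratfun C) : Prop :=
  exists w, has_value g z w.

(* Meaningful when g is regular at z; the value is then unique. *)
Definition ratfun_eval (C : fieldType) (z : C) (g : ratfun C) : C :=
  xget 0 [set w | has_value g z w].

(* Value at z of P(f_1, ..., f_n), for P in C(z)[X_1, ..., X_n]. *)
Definition eval_at (C : fieldType) (n : nat) (P : mpoly n (ratfun C))
    (f : 'I_n -> C -> C) (z : C) : C :=
  mmap (ratfun_eval z) (fun i => f i z) P.

(* Algebraic independence over C(z) of functions f_1, ..., f_n that are
   analytic on the connected open set D.  For P in C(z)[X_1, ..., X_n],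
   P(f_1, ..., f_n) is a meromorphic function on D, and it is zero if and only
   if it vanishes at all the points of D, with the exception of the (finitely
   many) poles of the coefficients of P. *)
Definition alg_independent (C : fieldType) (n : nat) (D : set C)
    (f : 'I_n -> C -> C) : Prop :=
  forall P : mpoly n (ratfun C),
    (forall z : C, D z ->
       (forall m, regular_at z (mcoeff m P)) -> eval_at P f z = 0) ->
    P = 0.

(* Main.v *)
Require Import Defs.
From mathcomp Require Import ring zify.

(** Let p(z) = sum_(i < k) (i+1) z^i and q(z) = sum_(i < k) z^i. Splitting off
    the last digit gives K(z) = p(z) K(z^k) + q(z) (q(z^k) K(z^(k^2)) - 1).
    Let z_0 <> 1 be a k-th root of unity and z_(n+1) a k-th root of z_n. As y
    tends radially to z_n, the number y^(k^(n+1)) tends to 1, K blows up, and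
    K(y) / K(y^k) tends to an explicit finite continued fraction, because
    q(z_0) = 0. Hence the top homogeneous part of an algebraic relation between
    K(z) and K(z^k) vanishes at (z_n, q(z_n) r_n), where
    r_(n+1) = (p/q)(z_(n+1)) + 1/r_n; moreover p/q has real part (k+1)/2 on the
    unit circle, so that no r_n is 0.

    Such a relation does not exist. Take P in C[z][X] nonzero with
    P(z_n, r_n) = 0 for all large n, of minimal degree d in X and without
    constant-in-X common factor. Substituting z -> z^k and X -> q/(qX - p)
    gives a polynomial P' of degree at most d in X with the same zeros, so P'
    is proportional to P over C(z). The factor is constant: its only possible
    zeros are the roots of q, and these are excluded because X = 0 is not a root
    of P(1, X). But P' has degree k h + (k-1) d in z, where h is that of P; so
    h = d = 0, which is absurd. *)

Set Implicit Arguments.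
Unset Strict Implicit.
Unset Printing Implicit Defensive.

Local Open Scope ring_scope.

(** * Polynomial relations along a tower of roots of unity *)

Section PolyExtra.
Variable F : fieldType.

Lemma poly_injective_roots (f : {poly F}) (t : nat -> F) :
  injective t -> (forall n, f.[t n] = 0) -> f = 0.
Proof.
move=> tI f0; apply/eqP/negPn/negP => fn0.
have := @max_poly_roots _ f (map t (iota 0 (size f))) fn0.
rewrite map_inj_uniq // iota_uniq size_map size_iota ltnn.
suff -> : all (root f) (map t (iota 0 (size f))) by move=> /(_ isT isT).
by apply/allP => x /mapP [n _ ->]; rewrite rootE f0.
Qed.

(** Here [m] is only a bound for the degree and [a] may be 0, so that products need no nonvanishing
    condition. *)
Definition lead_at (f : {poly F}) m a := (size f <= m.+1)%N /\ f`_m = a.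

Lemma lead_atM f g m n a b :
  lead_at f m a -> lead_at g n b -> lead_at (f * g) (m + n) (a * b).
Proof.
move=> [sf fa] [sg gb]; split.
  apply: leq_trans (size_polyMleq _ _) _.
  by move: (leq_add sf sg); lia.
rewrite coefM (bigD1 (inord m : 'I_(m + n).+1)) //= inordK; last lia.
rewrite fa addKn gb big1 ?addr0 // => j /eqP jm.
have {}jm : (j : nat) <> m by move=> e; apply: jm; apply: val_inj; rewrite /= inordK //; lia.
have [jlt|jgt] := leqP j m.
  rewrite [g`_ _]nth_default ?mulr0 //.
  by apply: leq_trans sg _; move/eqP: jm; lia.
by rewrite [f`_ _]nth_default ?mul0r //; apply: leq_trans sf _.
Qed.

Lemma lead_atX f m a e : lead_at f m a -> lead_at (f ^+ e) (m * e) (a ^+ e).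
Proof.
move=> tf; elim: e => [|e IH].
  by rewrite muln0 !expr0; split; rewrite ?size_poly1 // coef1.
by rewrite !exprS mulnS; apply: lead_atM.
Qed.

Lemma lead_at_comp_Xn f m a k : (0 < k)%N -> lead_at f m a -> lead_at (f \Po 'X^k) (k * m) a.
Proof.
move=> k0 [sf fa]; split.
  apply/leq_sizeP => j jm; rewrite coef_comp_poly_Xn //.
  case: ifP => // /dvdnP [i ji]; rewrite ji mulnK // nth_default //.
  by apply: leq_trans sf _; move: jm; rewrite ji; nia.
by rewrite coef_comp_poly_Xn // dvdn_mulr // mulKn.
Qed.

(** The sum is the value at [t n] of the polynomial whose coefficients are the [f i] in reverse
    order; it has infinitely many roots. *)
Lemma sum_revpow_eq0 (t : nat -> F) (f : nat -> F) d : injective t ->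
  (forall n, \sum_(i < d.+1) f i * t n ^+ (d - i) = 0) ->
  forall i, (i <= d)%N -> f i = 0.
Proof.
move=> tI f0 i id.
have : \poly_(j < d.+1) f (d - j)%N = 0.
  apply: (poly_injective_roots tI) => n; rewrite horner_poly.
  rewrite (reindex_inj rev_ord_inj) /= -[RHS](f0 n); apply: eq_bigr => j _.
  by rewrite subSS subKn // -ltnS.
move/(congr1 (fun g : {poly F} => g`_(d - i))).
by rewrite coef0 coef_poly ltnS leq_subr subKn.
Qed.

End PolyExtra.

(** * The polynomials p and q, and pullback along the Riccati map *)

Section Riccati.
Variables (C : numClosedFieldType) (k : nat).
Hypothesis hk : (2 <= k)%N.

Definition pk : {poly C} := \poly_(i < k) i.+1%:R.
Definition qk : {poly C} := \poly_(i < k) 1.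

Lemma horner_pk x : pk.[x] = \sum_(i < k) i.+1%:R * x ^+ i.
Proof. by rewrite horner_poly. Qed.

Lemma horner_qk x : qk.[x] = \sum_(i < k) x ^+ i.
Proof. by rewrite horner_poly; under eq_bigr do rewrite mul1r. Qed.

Lemma pk1_gt0 : 0 < pk.[1].
Proof.
rewrite horner_pk; have k0 : (0 < k)%N by lia.
apply: lt_le_trans (_ : \sum_(i < k) 1 <= _).
  by rewrite sumr_const card_ord ltr0n.
by apply: ler_sum => i _; rewrite expr1n mulr1 ler1n.
Qed.

Lemma qk1 : qk.[1] = k%:R.
Proof. by rewrite horner_qk; under eq_bigr do rewrite expr1n; rewrite sumr_const card_ord. Qed.

Lemma qk_geom x : qk.[x] * (x - 1) = x ^+ k - 1.
Proof. by rewrite horner_qk mulrC -subrX1. Qed.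

Lemma pk_geom x : pk.[x] * (x - 1) = k%:R * x ^+ k - qk.[x].
Proof.
rewrite horner_pk horner_qk; elim: k => [|m IH].
  by rewrite !big_ord0 !mul0r subrr.
rewrite !big_ord_recr /= mulrDl IH -natr1 exprS; ring.
Qed.

(** At a root of q one has x^k = 1, and [pk_geom] leaves p(x) (x - 1) = k. *)
Lemma pk_root_qk x : qk.[x] = 0 -> pk.[x] != 0.
Proof.
move=> qx; have xk : x ^+ k = 1.
  by apply/eqP; rewrite -subr_eq0 -qk_geom qx mul0r.
apply/eqP => px; have := pk_geom x; rewrite px qx xk mul0r subr0 mulr1 => /esym/eqP.
by rewrite pnatr_eq0; case: (k) hk.
Qed.

Lemma lead_at_qk : lead_at qk k.-1 1.
Proof.
split; first by rewrite prednK ?size_poly; lia.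
by rewrite coef_poly ifT //; lia.
Qed.

Lemma lead_at_lin x : lead_at (x%:P * qk - pk) k.-1 (x - k%:R).
Proof.
have -> : x%:P * qk - pk = \poly_(i < k) (x - i.+1%:R).
  apply/polyP => i; rewrite coefB coefCM !coef_poly.
  by case: ifP => _; rewrite ?mulr1 // mulr0 subr0.
split; first by rewrite prednK ?size_poly; lia.
by rewrite coef_poly ifT ?prednK //; lia.
Qed.

(* If Y is a root of P(z^k, Y) then X = p/q + 1/Y, that is Y = q/(qX - p), is a
   root of pull P d (z, X). *)
Definition pull (P : {poly {poly C}}) d : {poly {poly C}} :=
  \sum_(i < d.+1) ((P`_i \Po 'X^k) * qk ^+ i) *: (qk *: 'X - pk%:P) ^+ (d - i).

Lemma pull_horner P d x : (pull P d).[x%:P] =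
  \sum_(i < d.+1) (P`_i \Po 'X^k) * qk ^+ i * (x%:P * qk - pk) ^+ (d - i).
Proof.
rewrite /pull horner_sum; apply: eq_bigr => i _.
by rewrite hornerZ horner_exp !hornerE [qk * _]mulrC.
Qed.

Lemma pull_horner2 P d x c : (pull P d).[x%:P].[c] =
  \sum_(i < d.+1) (P`_i).[c ^+ k] * qk.[c] ^+ i * (qk.[c] * x - pk.[c]) ^+ (d - i).
Proof.
rewrite pull_horner horner_sum; apply: eq_bigr => i _.
by rewrite !hornerM !horner_exp !hornerE horner_comp !hornerE [x * _]mulrC.
Qed.

Lemma size_lin_exp m : (size ((qk *: 'X - pk%:P) ^+ m) <= m.+1)%N.
Proof.
apply: leq_trans (size_poly_exp_leq _ _) _.
suff : (size (qk *: 'X - pk%:P)%R <= 2)%N by move=> ?; rewrite ltnS; nia.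
apply: leq_trans (size_polyD _ _) _; rewrite geq_max size_polyN.
rewrite (leq_trans (size_polyC_leq1 _)) // andbT.
by apply: leq_trans (size_scale_leq _ _) _; rewrite size_polyX.
Qed.

Lemma lin_exp_coef m : ((qk *: 'X - pk%:P) ^+ m)`_m = qk ^+ m.
Proof.
elim: m => [|m IH]; first by rewrite !expr0 coef1.
rewrite exprS mulrBl coefB -scalerAl coefZ coefXM /= IH coefCM.
rewrite [_`_m.+1]nth_default ?mulr0 ?subr0 ?exprS //; exact: size_lin_exp.
Qed.

Lemma size_pull P d : (size (pull P d) <= d.+1)%N.
Proof.
apply: leq_trans (size_sum _ _ _) _; apply/bigmax_leqP => i _.
apply: leq_trans (size_scale_leq _ _) _.
by apply: leq_trans (size_lin_exp _) _; lia.
Qed.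

(** Since (q X - p)^(d - i) has degree at most d - i in X, only i = 0 reaches X^d. *)
Lemma pull_coef P d : (pull P d)`_d = (P`_0 \Po 'X^k) * qk ^+ d.
Proof.
rewrite coef_sum (bigD1 ord0) //= coefZ subn0 lin_exp_coef expr0 mulr1.
rewrite big1 ?addr0 // => i /negP i0; rewrite coefZ [_`_d]nth_default ?mulr0 //.
apply: leq_trans (size_lin_exp _) _.
suff : (0 < i)%N by move: (ltn_ord i); lia.
by rewrite lt0n; apply/negP => /eqP i0'; apply: i0; apply/eqP/val_inj.
Qed.

Variables (z r : nat -> C).
Hypothesis z_inj : injective z.
Hypothesis zk : forall n, z n.+1 ^+ k = z n.
Hypothesis r0 : forall n, r n != 0.
Hypothesis rS : forall n, r n.+1 * qk.[z n.+1] = pk.[z n.+1] + qk.[z n.+1] / r n.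

(** Finitely many indices are ignored, so that a common factor z - c of the coefficients can be
    cancelled even if c is some [z n]. *)
Definition vanishes (P : {poly {poly C}}) :=
  exists N, forall n, (N <= n)%N -> P.[(r n)%:P].[z n] = 0.

(** By [rS], q X - p takes the value q / r_n at (z_(n+1), r_(n+1)), so the pullback there is (q /
    r_n)^d P(z_n, r_n). *)
Lemma vanishes_pull (P : {poly {poly C}}) d :
  (size P <= d.+1)%N -> vanishes P -> vanishes (pull P d).
Proof.
move=> sP [N PN]; exists N.+1 => -[//|n] nN; rewrite pull_horner2 zk.
have -> : qk.[z n.+1] * r n.+1 - pk.[z n.+1] = qk.[z n.+1] / r n.
  by rewrite mulrC rS addrC addKr.
transitivity (qk.[z n.+1] ^+ d * (r n)^-1 ^+ d * P.[(r n)%:P].[z n]); last first.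
  by rewrite PN ?mulr0.
rewrite (horner_coef_wide _ sP) horner_sum mulr_sumr; apply: eq_bigr => i _.
have id : (i <= d)%N by rewrite -ltnS.
rewrite hornerM horner_exp hornerC exprMn.
have e (x : C) : x ^+ d = x ^+ (d - i) * x ^+ i by rewrite -exprD subnK.
rewrite (e qk.[z n.+1]) (e (r n)^-1) [(r n)^-1 ^+ i]exprVn; field.
by rewrite expf_neq0.
Qed.

Lemma vanishes_comb (a b : {poly C}) (P Q : {poly {poly C}}) :
  vanishes P -> vanishes Q -> vanishes (a *: P - b *: Q).
Proof.
move=> [N PN] [M QM]; exists (maxn N M) => n; rewrite geq_max => /andP[nN nM].
by rewrite hornerD !hornerN !hornerZ hornerD hornerN !hornerM PN // QM // !mulr0 subrr.
Qed.

Lemma coef_eq_horner (P Q : {poly {poly C}}) (a b : {poly C}) c i :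
  a *: P = b *: Q -> a.[c] * (P`_i).[c] = b.[c] * (Q`_i).[c].
Proof.
by move/(congr1 (fun U : {poly {poly C}} => (U`_i).[c])); rewrite !coefZ !hornerM.
Qed.

Lemma natr_inj : injective (fun n => n%:R : C).
Proof. by move=> m n /eqP; rewrite eqr_nat => /eqP. Qed.

Lemma no_root_const (a : {poly C}) : (forall c, a.[c] != 0) ->
  exists2 a0, a0 != 0 & a = a0%:P.
Proof.
move=> ac; have /size_poly1P [a0 a00 ->] : size a == 1%N.
  apply/eqP/eqP/negPn/negP => /closed_rootP [c]; rewrite rootE.
  by rewrite (negbTE (ac c)).
by exists a0.
Qed.

(** * Primitive polynomials proportional to their pullback *)

Section Primitive.
Variables (P : {poly {poly C}}) (d : nat).
Hypothesis sP : size P = d.+1.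
Hypothesis primP : forall c, ~ (forall i, (P`_i).[c] = 0).

Lemma primitive_low c : ~ (forall i, (i <= d)%N -> (P`_i).[c] = 0).
Proof.
move=> H; apply: (primP (c := c)) => i; have [/H//|di] := leqP i d.
by rewrite nth_default ?horner0 ?sP.
Qed.

Lemma horner2_coef x c : P.[x%:P].[c] = \sum_(i < d.+1) (P`_i).[c] * x ^+ i.
Proof.
rewrite (horner_coef P) sP horner_sum; apply: eq_bigr => i _.
by rewrite hornerM horner_exp hornerC.
Qed.

(** If q(c) is nonzero, q(c) X - p(c) takes all values and P would vanish identically at z = c^k,
    against [primP]. If q(c) = 0, then c^k = 1 and only the term i = 0 is left. *)
Lemma pull_root_q c : (forall i, ((pull P d)`_i).[c] = 0) ->
  qk.[c] = 0 /\ (P`_0).[1] = 0.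
Proof.
move=> Tc; have T0 x : (pull P d).[x%:P].[c] = 0.
  rewrite (horner_coef (pull P d)) horner_sum big1 // => i _.
  by rewrite hornerM Tc mul0r.
have [qc|qc] := eqVneq qk.[c] 0; last first.
  case: (@primitive_low (c ^+ k)) => i id.
  suff /(_ i id) /eqP : forall j, (j <= d)%N -> (P`_j).[c ^+ k] * qk.[c] ^+ j = 0.
    by rewrite mulf_eq0 expf_eq0 (negbTE qc) andbF orbF => /eqP.
  apply: (sum_revpow_eq0 natr_inj) => n.
  (* This value of X makes q(c) X - p(c) equal to n. *)
  rewrite -[RHS](T0 ((n%:R + pk.[c]) / qk.[c])) pull_horner2.
  by apply: eq_bigr => j _; rewrite mulrCA divff // mulr1 addrK.
split=> //; have ck : c ^+ k = 1.
  by apply/eqP; rewrite -subr_eq0 -qk_geom qc mul0r.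
have := T0 0; rewrite pull_horner2 (bigD1 ord0) //= big1 => [|i i0].
  rewrite ck expr0 mulr1 qc mul0r sub0r addr0 => /eqP.
  by rewrite mulf_eq0 expf_eq0 oppr_eq0 (negbTE (pk_root_qk qc)) andbF orbF => /eqP.
by rewrite qc expr0n (negbTE (i0 : i != 0%N :> nat)) mulr0 mul0r.
Qed.

(* At z = 1 the map X |-> p/q + 1/X acts on the roots in P^1 of P(1, X); a root
   at 0 would have the infinite orbit 0, oo, A, A + 1/A, ... with A = p(1)/q(1). *)
Lemma coef0_at1_neq0 (a b : C) : a != 0 -> b != 0 ->
  (forall i, b * ((pull P d)`_i).[1] = a * (P`_i).[1]) -> (P`_0).[1] != 0.
Proof.
move=> a0 b0 ab; apply/eqP => P0.
pose A : C := pk.[1] / k%:R.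
have k0 : (0 : C) < k%:R by rewrite ltr0n; lia.
have A0 : 0 < A by rewrite divr_gt0 // pk1_gt0.
have ev x : b * (pull P d).[x%:P].[1] = a * P.[x%:P].[1].
  rewrite horner2_coef (horner_coef_wide _ (size_pull _ _)) horner_sum !mulr_sumr.
  by apply: eq_bigr => i _; rewrite hornerM horner_exp hornerC !mulrA ab.
(* Infinity is a root as well: the coefficient of X^d in the pullback is P_0(z^k) q^d, which is 0 at
   z = 1. *)
have Pd : (P`_d).[1] = 0.
  have := ab d; rewrite pull_coef hornerM horner_comp hornerXn expr1n P0 mul0r mulr0.
  by move/esym/eqP; rewrite mulf_eq0 (negbTE a0) => /eqP.
pose t := fix t n := if n is m.+1 then A + (t m)^-1 else A.
have tpos n : 0 < t n by elim: n => //= n IH; rewrite addr_gt0 // invr_gt0.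
have root_of x : (pull P d).[x%:P].[1] = 0 -> P.[x%:P].[1] = 0.
  by move=> Tx; have /esym/eqP := ev x; rewrite Tx mulr0 mulf_eq0 (negbTE a0) => /eqP.
have Pt n : P.[(t n)%:P].[1] = 0.
  elim: n => [|n IH]; apply: root_of; rewrite pull_horner2 expr1n qk1.
    (* At X = A the factor q X - p is 0, so only i = d is left, and that term contains P_d(1) =
       0. *)
    apply: big1 => i _; rewrite /t /A mulrCA divff ?gt_eqF // mulr1 subrr.
    rewrite expr0n subn_eq0; have [di|] := leqP d i; last by rewrite mulr0.
    have -> : (i : nat) = d by apply/eqP; rewrite eqn_leq di -ltnS ltn_ord.
    by rewrite Pd !mul0r.
  transitivity (k%:R ^+ d * (t n)^-1 ^+ d * P.[(t n)%:P].[1]); last first.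
    by rewrite IH mulr0.
  rewrite horner2_coef mulr_sumr; apply: eq_bigr => i _ /=.
  have id : (i <= d)%N by rewrite -ltnS.
  rewrite mulrDr /A (mulrCA _ pk.[1]) divff ?gt_eqF // mulr1 addrAC subrr add0r exprMn.
  have e (x : C) : x ^+ d = x ^+ (d - i) * x ^+ i by rewrite -exprD subnK.
  rewrite (e k%:R) (e (t n)^-1) [(t n)^-1 ^+ i]exprVn; field.
  by rewrite expf_neq0 // gt_eqF.
(* All terms are positive, so every later one exceeds A = [t 0]; the other cases follow by
   cancelling A and inverting. *)
have tI : injective t.
  have t0 n : t n.+1 != t 0%N by rewrite /= gt_eqF // ltrDl invr_gt0.
  move=> m; elim: m => [|m IH] [|n] // e.
  - by move/eqP: (esym e); rewrite (negbTE (t0 n)).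
  - by move/eqP: e; rewrite (negbTE (t0 m)).
  - by congr _.+1; apply: IH; apply: invr_inj; apply: (addrI A).
have f0 : \poly_(i < d.+1) (P`_i).[1] = 0.
  apply: (poly_injective_roots tI) => n; rewrite horner_poly -[RHS](Pt n).
  by rewrite horner2_coef.
apply: (@primitive_low 1) => i id; move/(congr1 (fun g : {poly C} => g`_i)): f0.
by rewrite coef0 coef_poly ltnS id.
Qed.

(** Degrees in z are compared: the coefficient of z^D in the pullback is a nonzero polynomial in x -
    k, whereas P has degree at most h in z. Hence D <= h, and k >= 2 leaves h = d = 0. *)
Lemma primitive_pull_const (a b : C) : a != 0 -> b != 0 ->
  b%:P *: pull P d = a%:P *: P -> d = 0%N /\ exists2 c, c != 0 & P = c%:P%:P.
Proof.
move=> a0 b0 ab.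
pose h := (\max_(i < d.+1) size (P`_i)%R).-1.
have hmax (i : 'I_d.+1) : (size (P`_i)%R <= h.+1)%N.
  by apply: leq_trans (leqSpred _); apply: (leq_bigmax i).
have [i0 hi0] : exists i : 'I_d.+1, P`_i`_h != 0.
  have [j jmax] : exists j : 'I_d.+1, \max_(i < d.+1) size (P`_i)%R = size (P`_j)%R.
    have [|j jE] := @bigop.eq_bigmax _ (fun i : 'I_d.+1 => size (P`_i)%R).
      by rewrite card_ord.
    by exists j.
  exists j; rewrite /h jmax -lead_coefE lead_coef_eq0 -size_poly_gt0 -jmax.
  apply: leq_trans (leq_bigmax (ord_max : 'I_d.+1)); rewrite /= size_poly_gt0.
  have : lead_coef P != 0 by rewrite lead_coef_eq0 -size_poly_gt0 sP.
  by rewrite lead_coefE sP.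
have Ptop (i : 'I_d.+1) : lead_at (P`_i) h (P`_i`_h) by split.
pose D := (k * h + k.-1 * d)%N.
have Dcoef (x : C) : ((pull P d).[x%:P])`_D =
    \sum_(i < d.+1) P`_i`_h * (x - k%:R) ^+ (d - i).
  rewrite pull_horner coef_sum; apply: eq_bigr => i _.
  have id : (i <= d)%N by rewrite -ltnS.
  have k0 : (0 < k)%N by lia.
  have := lead_atM (lead_atM (lead_at_comp_Xn k0 (Ptop i)) (lead_atX i lead_at_qk))
    (lead_atX (d - i) (lead_at_lin x)).
  rewrite expr1n mulr1 => -[_ <-]; congr (_`_ _).
  by rewrite /D -addnA -mulnDr subnKC.
have Dle : (D <= h)%N.
  rewrite leqNgt; apply/negP => hD.
  suff H : forall j, (j <= d)%N -> P`_j`_h = 0.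
    by move/eqP: hi0; apply; apply: H; rewrite -ltnS.
  apply: (sum_revpow_eq0 natr_inj) => n.
  (* Evaluating at x = n + k turns the powers of x - k into powers of n. *)
  have := Dcoef (n%:R + k%:R); rewrite addrK => <-.
  have : b * ((pull P d).[(n%:R + k%:R)%:P])`_D = 0.
    rewrite -coefCM -hornerZ ab hornerZ coefCM (horner_coef P) sP.
    rewrite coef_sum big1 ?mulr0 // => i _.
    rewrite -rmorphXn /= coefMC [_`_D]nth_default ?mul0r //.
    exact: leq_trans (hmax i) _.
  by move/eqP; rewrite mulf_eq0 (negbTE b0) => /eqP.
have {Dle} [h0 d0] : h = 0%N /\ d = 0%N by move: Dle; rewrite /D; nia.
split=> //; exists (P`_0`_0).
  by move: hi0; rewrite h0; case: i0 => -[|i] //=; rewrite d0.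
have := hmax ord0; rewrite h0 => /size1_polyC {1}<-.
by apply: size1_polyC; rewrite sP d0.
Qed.

(** The hypothesis on [D] expresses minimality of the degree in X. It makes the pullback
    proportional to P; the two factors, once coprime, are shown to have no root. *)
Lemma primitive_not_vanishes : vanishes P ->
  (forall D : {poly {poly C}}, (size D <= d)%N -> vanishes D -> D = 0) -> False.
Proof.
move=> vP IH.
pose al := (pull P d)`_d; pose be := P`_d.
have be0 : be != 0.
  have : lead_coef P != 0 by rewrite lead_coef_eq0 -size_poly_gt0 sP.
  by rewrite lead_coefE sP.
(* The difference has no term in X^d, so minimality applies to it. *)
have prop : be *: pull P d = al *: P.
  apply/eqP; rewrite -subr_eq0; apply/eqP; apply: IH; last first.
    by apply: vanishes_comb => //; apply: vanishes_pull => //; rewrite sP.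
  apply/leq_sizeP => j dj; rewrite coefB !coefZ; move: dj.
  rewrite leq_eqVlt => /orP [/eqP <-|dj]; first by rewrite /al /be mulrC subrr.
  rewrite !nth_default ?mulr0 ?subr0 ?sP //; exact: leq_trans (size_pull _ _) _.
pose g := gcdp be al.
have g0 : g != 0 by rewrite gcdp_eq0 negb_and be0.
pose al' := al %/ g; pose be' := be %/ g.
have cop : coprimep be' al' by apply: coprimep_div_gcd; rewrite be0.
have {}prop : be' *: pull P d = al' *: P.
  have [alE beE] : al = al' * g /\ be = be' * g by rewrite !divpK ?dvdp_gcdl ?dvdp_gcdr.
  move: prop; rewrite alE beE ![_ * g]mulrC -!mul_polyC !polyCM -!mulrA.
  by apply: mulfI; rewrite polyC_eq0.
have both c : be'.[c] = 0 -> al'.[c] != 0.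
  by move=> bc; apply: (coprimep_root cop); rewrite /root bc.
(* At a root of [be'] the other factor is nonzero, so all coefficients of P would vanish there. *)
have [b b0 bE] : exists2 b, b != 0 & be' = b%:P.
  apply: no_root_const => c; apply/eqP => bc; apply: (primP (c := c)) => i.
  have /esym/eqP := coef_eq_horner c i prop; rewrite bc mul0r mulf_eq0.
  by rewrite (negbTE (both _ bc)) => /eqP.
have aroot c : al'.[c] = 0 -> qk.[c] = 0 /\ (P`_0).[1] = 0.
  move=> ac; apply: pull_root_q => i.
  have /eqP := coef_eq_horner c i prop; rewrite ac mul0r bE hornerC mulf_eq0.
  by rewrite (negbTE b0) => /eqP.
have a1 : al'.[1] != 0.
  apply/eqP => /aroot [/eqP]; rewrite qk1 pnatr_eq0; lia.
have P01 : (P`_0).[1] != 0.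
  apply: (coef0_at1_neq0 a1 b0) => i.
  by rewrite -(coef_eq_horner 1 i prop) bE hornerC.
have [a a0 aE] : exists2 a, a != 0 & al' = a%:P.
  by apply: no_root_const => c; apply/eqP => /aroot [_ /eqP]; rewrite (negbTE P01).
rewrite aE bE in prop; have [_ [c c0 Pc]] := primitive_pull_const a0 b0 prop.
case: vP => N /(_ N (leqnn N)); rewrite Pc !hornerC => /eqP.
by rewrite (negbTE c0).
Qed.

End Primitive.

(** Outer induction on the size in X, inner induction on the total size of the coefficients, which
    drops when a common linear factor is divided out. *)
Theorem vanishes_eq0 (P : {poly {poly C}}) : vanishes P -> P = 0.
Proof.
move: {2}(size P) (leqnn (size P)) => s; elim: s P => [|d IH] P.
  by rewrite leqn0 size_poly_eq0 => /eqP.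
pose ht (Q : {poly {poly C}}) := (\sum_(i < d.+1) size (Q`_i)%R)%N.
move: {2}(ht P) (leqnn (ht P)) => h; elim: h P => [|h IHh] P hP sP vP.
  apply/polyP => i; rewrite coef0; have [id|id] := ltnP i d.+1; last first.
    by rewrite nth_default // (leq_trans sP).
  apply/eqP; rewrite -size_poly_eq0 -leqn0; apply: leq_trans hP.
  by rewrite /ht (bigD1 (Ordinal id)) //= leq_addr.
move: sP; rewrite leq_eqVlt => /orP [/eqP sP|]; last by rewrite ltnS => /IH; apply.
have [[c cP]|prim] := EM (exists c, forall i, (P`_i).[c] = 0); last first.
  exfalso; apply: (primitive_not_vanishes sP) => // c cP.
  by apply: prim; exists c.
have divX i : P`_i = (P`_i %/ ('X - c%:P)) * ('X - c%:P).
  by apply/eqP; rewrite -dvdp_eq dvdp_XsubCl rootE cP.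
pose Q := \poly_(i < d.+1) (P`_i %/ ('X - c%:P)).
have PQ : P = ('X - c%:P) *: Q.
  apply/polyP => i; rewrite coefZ coef_poly; case: ltnP => id.
    by rewrite mulrC -divX.
  by rewrite mulr0 nth_default // sP.
have sQ : (size Q <= d.+1)%N by apply: size_poly.
suff Q0 : Q = 0 by rewrite PQ Q0 scaler0.
apply: IHh => //.
  rewrite -ltnS; apply: leq_trans hP; rewrite /ht.
  rewrite (bigD1 ord_max) //= [X in (_ < X)%N](bigD1 ord_max) //= -addSn.
  have szQ i : (i < d.+1)%N -> (size (Q`_i)%R = (size (P`_i)%R).-1)%N.
    by move=> id; rewrite coef_poly id size_divp ?polyXsubC_eq0 // size_XsubC subn1.
  apply: leq_add; last by apply: leq_sum => i _; rewrite szQ // leq_pred.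
  rewrite szQ // prednK // size_poly_gt0.
  have : lead_coef P != 0 by rewrite lead_coef_eq0 -size_poly_gt0 sP.
  by rewrite lead_coefE sP.
case: vP => N PN.
(* As [z] is injective, z - c vanishes at no more than one [z n]. *)
have [M zM] : exists M, forall n, (M <= n)%N -> z n != c.
  have [[m zm]|nz] := EM (exists m, z m = c).
    exists m.+1 => n mn; apply/eqP; rewrite -zm => /z_inj nm; move: mn.
    by rewrite nm ltnn.
  by exists 0%N => n _; apply/eqP => zn; apply: nz; exists n.
exists (maxn N M) => n; rewrite geq_max => /andP [nN nM].
have /eqP := PN n nN; rewrite PQ hornerZ hornerM !hornerE mulf_eq0 subr_eq0.
by rewrite (negbTE (zM n nM)) => /eqP.
Qed.

End Riccati.

Local Open Scope classical_set_scope.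

(** * Radial asymptotics *)

Lemma cvg_ext (T : topologicalType) (u v : nat -> T) (l : T) :
  (forall n, u n = v n) -> u @ \oo --> l -> v @ \oo --> l.
Proof. by move=> /funext ->. Qed.

Lemma cvg_sub (T : topologicalType) (u : nat -> T) (l : T) (phi : nat -> nat) :
  (forall n, (n <= phi n)%N) -> u @ \oo --> l -> (fun n => u (phi n)) @ \oo --> l.
Proof.
move=> phin ul A /ul [N _ H]; exists N => // n /= Nn; apply: H => /=.
exact: leq_trans (phin n).
Qed.

Section Limits.
Variable C : numClosedFieldType.
Implicit Types u v : nat -> C.

Lemma cvg_horner (f : {poly C}) u l :
  u @ \oo --> l -> (fun n => f.[u n]) @ \oo --> f.[l].
Proof.
move=> ul; elim/poly_ind: f => [|f c IH].
  under eq_fun do rewrite horner0; rewrite horner0; exact: cvg_cst.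
under eq_fun do rewrite hornerD hornerC hornerMX.
rewrite hornerD hornerC hornerMX; apply: cvgD; last exact: cvg_cst.
exact: cvgM.
Qed.

Lemma cvg0_bounded u v M : u @ \oo --> (0 : C) -> (forall n, `|v n| <= M) ->
  (fun n => u n * v n) @ \oo --> (0 : C).
Proof.
move=> u0 vM; have M0 : 0 <= M by apply: le_trans (vM 0%N).
apply/(cvgr0Pnorm_le (V := C^o)) => e e0.
have e1 : 0 < e / (M + 1) by rewrite divr_gt0 // ltr_wpDl.
move/(cvgr0Pnorm_le (V := C^o)): u0 => /(_ _ e1).
apply: filterS => n un; rewrite normrM.
apply: le_trans (ler_pM (normr_ge0 _) (normr_ge0 _) un (vM n)) _.
rewrite -mulrA ler_piMr // ?(ltW e0) // mulrC ler_pdivrMr ?mul1r ?lerDl //.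
by rewrite ltr_wpDl.
Qed.

Lemma cvgCD u v (a b : C) : u @ \oo --> a -> v @ \oo --> b ->
  (fun n => u n + v n) @ \oo --> a + b.
Proof. exact: (cvgD (V := C^o)). Qed.

Lemma cvgCB u v (a b : C) : u @ \oo --> a -> v @ \oo --> b ->
  (fun n => u n - v n) @ \oo --> a - b.
Proof. exact: (cvgB (V := C^o)). Qed.

Lemma cvgCM u v (a b : C) : u @ \oo --> a -> v @ \oo --> b ->
  (fun n => u n * v n) @ \oo --> a * b.
Proof. exact: cvgM. Qed.

Lemma cvgCst (a : C) : (fun _ : nat => a) @ \oo --> a.
Proof. exact: cvg_cst. Qed.

Lemma cvgC_unique u (a b : C) : u @ \oo --> a -> u @ \oo --> b -> a = b.
Proof. exact: (cvg_unique (@norm_hausdorff _ C^o)). Qed.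

Lemma cvg_sum_seq (T : Type) (r : seq T) (f : T -> nat -> C) (l : T -> C) :
  (forall i, f i @ \oo --> l i) ->
  (fun n => \sum_(i <- r) f i n) @ \oo --> \sum_(i <- r) l i.
Proof.
move=> fl; elim: r => [|i r IH].
  under eq_fun do rewrite big_nil; rewrite big_nil; exact: cvgCst.
under eq_fun do rewrite big_cons; rewrite big_cons.
exact: cvgCD.
Qed.

Lemma cvg_pow (u : nat -> C) (l : C) e : u @ \oo --> l -> (fun n => u n ^+ e) @ \oo --> l ^+ e.
Proof.
move=> ul; under eq_fun do rewrite -[_ ^+ e]hornerXn.
by rewrite -[l ^+ e]hornerXn; exact: cvg_horner.
Qed.

End Limits.

(** * The tower of k-th roots and its continued fractions *)

Section Tower.
Variables (C : numClosedFieldType) (k : nat).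
Hypothesis hk : (2 <= k)%N.
Let p := pk C k.
Let q := qk C k.
Variable z : nat -> C.
Hypothesis z0 : q.[z 0%N] = 0.
Hypothesis zS : forall n, z n.+1 ^+ k = z n.

Lemma tower_pow n m : z (m + n) ^+ (k ^ m) = z n.
Proof.
elim: m => [|m IH]; first by rewrite expn0 expr1.
by rewrite expnS exprM addSn zS.
Qed.

Lemma tower_pow1 n : z n ^+ (k ^ n.+1) = 1.
Proof.
rewrite expnSr exprM -[X in z X]addn0 tower_pow.
by apply/eqP; rewrite -subr_eq0 -qk_geom z0 mul0r.
Qed.

Lemma tower_neq1 n : z n != 1.
Proof.
apply/eqP => zn1; have := tower_pow 0 n; rewrite addn0 zn1 expr1n => z01.
by move/eqP: z0; rewrite -z01 qk1 pnatr_eq0; lia.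
Qed.

Lemma tower_norm n : `|z n| = 1.
Proof.
have := congr1 Num.norm (tower_pow1 n); rewrite normrX normr1 => /eqP.
by rewrite pexpr_eq1 // ?expn_gt0; [move/eqP|lia].
Qed.

(** q(z_(n+1)) (z_(n+1) - 1) = z_n - 1, and no z_n is 1. *)
Lemma tower_qk n : q.[z n.+1] != 0.
Proof.
apply/eqP => qz; have := qk_geom k (z n.+1); rewrite -/q qz mul0r zS => /esym/eqP.
by rewrite subr_eq0 (negbTE (tower_neq1 n)).
Qed.

(** Raising to the power k^n sends z_n to z_0, but z_m with m < n to 1. *)
Lemma tower_inj : injective z.
Proof.
have main m n : (m < n)%N -> z m <> z n.
  move=> mn e; have := tower_pow 0 n; rewrite addn0 -e.
  rewrite -(subnK mn) expnD mulnC exprM tower_pow1 expr1n => /esym/eqP.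
  by rewrite (negbTE (tower_neq1 0)).
move=> m n e; case: (ltngtP m n) => // mn; first by case: (main _ _ mn).
by case: (main _ _ mn).
Qed.

(* On |x| = 1, reversing coefficients gives p(x) + x^(k-1) p(1/x) = (k+1) q(x),
   so that p/q has real part (k+1)/2. *)
Lemma pq_real x : `|x| = 1 -> q.[x] != 0 ->
  p.[x] / q.[x] + (p.[x] / q.[x])^* = k.+1%:R.
Proof.
move=> x1 qx; have x0 : x != 0 by rewrite -normr_eq0 x1 oner_neq0.
have xc : x^* = x^-1 by rewrite invC_norm x1 expr1n invr1 mul1r.
have k0 : (0 < k)%N by lia.
have qc : x ^+ k.-1 * (q.[x])^* = q.[x].
  rewrite /q !horner_qk rmorph_sum mulr_sumr [RHS](reindex_inj rev_ord_inj) /=.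
  apply: eq_bigr => i _; rewrite rmorphXn /= xc.
  have ik : (i <= k.-1)%N by move: (ltn_ord i); lia.
  have -> : (k - i.+1 = k.-1 - i)%N by lia.
  by rewrite exprVn -{1}(subnK ik) exprD mulfK // expf_neq0.
have pc : x ^+ k.-1 * (p.[x])^* + p.[x] = k.+1%:R * q.[x].
  rewrite /p /q horner_qk !horner_pk rmorph_sum !mulr_sumr (reindex_inj rev_ord_inj) /=.
  rewrite -big_split /=; apply: eq_bigr => i _; rewrite rmorphM rmorphXn /= xc.
  have ik : (i <= k.-1)%N by move: (ltn_ord i); lia.
  have -> : (k - i.+1 = k.-1 - i)%N by lia.
  rewrite rmorph_nat exprVn -{1}(subnKC ik) exprD mulrCA mulfK ?expf_neq0 //.
  by rewrite -mulrDl -natrD; congr (_%:R * _); lia.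
have xk : x ^+ k.-1 != 0 by rewrite expf_neq0.
have -> : (p.[x] / q.[x])^* = (k.+1%:R * q.[x] - p.[x]) / q.[x].
  by rewrite -pc addrK -[X in _ = _ / X]qc rmorphM fmorphV /= -mulf_div divff // mul1r.
by rewrite -mulrDl addrC subrK mulfK.
Qed.

(* The limits of K(y) / K(x) and of K(y^k) / K(x), where x = y^(k^(n+1)), as y
   tends radially to z n. *)
Fixpoint contin n : C * C :=
  if n is m.+1 then
    (p.[z m.+1] * (contin m).1 + q.[z m.+1] * q.[z m] * (contin m).2, (contin m).1)
  else (p.[z 0%N], 1).

(** This is r_(n+1); the index is shifted because q(z_0) = 0. Dividing by q turns the linear
    recursion of [contin] into the Riccati recursion [rhoS]. *)
Definition rho n := (contin n.+1).1 / ((contin n.+1).2 * q.[z n.+1]).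

Lemma half_plane_neq0 (x : C) : 0 < x + x^* -> x != 0.
Proof. by apply: contraTneq => ->; rewrite conjC0 addr0 ltxx. Qed.

(** The sum equals 2 Re(x) / |x|^2. Stability of the right half-plane under inversion is what keeps
    every [rho n] nonzero. *)
Lemma half_plane_inv (x : C) : 0 < x + x^* -> 0 < x^-1 + (x^-1)^*.
Proof.
move=> xpos; have x0 := half_plane_neq0 xpos.
have xc0 : x^* != 0 by rewrite conjC_eq0.
have -> : x^-1 + (x^-1)^* = (x + x^*) / (x * x^*) 
  by rewrite fmorphV invfM mulrDl mulrA divff // mul1r mulrCA divff // mulr1 addrC.
by rewrite divr_gt0 // mul_conjC_gt0.
Qed.

Lemma pq_half_plane n : 0 < p.[z n.+1] / q.[z n.+1] + (p.[z n.+1] / q.[z n.+1])^*.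
Proof. by rewrite pq_real ?tower_norm ?tower_qk // ltr0n. Qed.

Lemma rhoS_aux n : (contin n.+1).2 != 0 -> rho n != 0 ->
  rho n.+1 = p.[z n.+2] / q.[z n.+2] + (rho n)^-1.
Proof.
move=> c20; have q1 := tower_qk n; have q2 := tower_qk n.+1.
rewrite /rho mulf_eq0 negb_or => /andP [c10 _].
set c := contin n.+1 in c10 c20 *.
have -> : contin n.+2 = (p.[z n.+2] * c.1 + q.[z n.+2] * q.[z n.+1] * c.2, c.1) by [].
by rewrite /=; field; rewrite q1 q2 c10 c20.
Qed.

(** Both facts go together: the next denominator [(contin n.+2).2] is [(contin n.+1).1], which is
    nonzero because [rho n] is. *)
Lemma rho_spec n : (contin n.+1).2 != 0 /\ 0 < rho n + (rho n)^*.
Proof.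
elim: n => [|n [c0 IH]].
  have c0 : p.[z 0%N] != 0 by apply: pk_root_qk.
  (* Since q(z_0) = 0, the continued fraction starts with p/q alone. *)
  split=> //; have -> : rho 0 = p.[z 1%N] / q.[z 1%N].
    by rewrite /rho /= z0 mulr0 mul0r addr0; field; rewrite c0 tower_qk.
  exact: pq_half_plane.
have r0 := half_plane_neq0 IH; rewrite (rhoS_aux c0 r0); split.
  by move: r0; rewrite /rho mulf_eq0 negb_or => /andP [].
by rewrite rmorphD addrACA addr_gt0 ?pq_half_plane ?half_plane_inv.
Qed.

Lemma rho_neq0 n : rho n != 0.
Proof. by have [_ /half_plane_neq0] := rho_spec n. Qed.

Lemma rhoS n : rho n.+1 * q.[z n.+2] = p.[z n.+2] + q.[z n.+2] / rho n.
Proof.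
have q2 := tower_qk n.+1; have [c0 _] := rho_spec n.
rewrite rhoS_aux ?rho_neq0 //; field; by rewrite q2 rho_neq0.
Qed.

Lemma contin_rho n : (contin n.+1).1 = rho n * q.[z n.+1] * (contin n.+1).2.
Proof.
by rewrite /rho invfM; have [c0 _] := rho_spec n; have := tower_qk n; move=> ?; field; apply/andP.
Qed.

(** * Radial limits of a solution of the functional equation *)

Variable K : C -> C.
Hypothesis K_eq : forall x, `|x| < 1 ->
  K x = p.[x] * K (x ^+ k) + q.[x] * (q.[x ^+ k] * K ((x ^+ k) ^+ k) - 1).
Hypothesis K_mono : forall x, 0 < x < 1 -> `|K (x ^+ k)| <= `|K x|.
Hypothesis K_low : forall x, 0 < x < 1 -> 1 <= (1 - x) * `|K x|.

Lemma K_neq0 x : 0 < x < 1 -> K x != 0.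
Proof.
move=> /K_low; apply: contraTneq => ->; rewrite normr0 mulr0.
by rewrite lt_geF // ltr01.
Qed.

Lemma K_inv_cvg (x : nat -> C) : (forall m, 0 < x m < 1) ->
  x @ \oo --> (1 : C) -> (fun m => (K (x m))^-1) @ \oo --> (0 : C).
Proof.
move=> x01 x1.
have d0 : (fun m => 1 - x m) @ \oo --> (0 : C).
  rewrite -(subrr 1); apply: cvgCB => //; exact: cvgCst.
apply/(cvgr0Pnorm_le (V := C^o)) => e e0.
move/(cvgr0Pnorm_le (V := C^o)): d0 => /(_ _ e0).
apply: filterS => m; apply: le_trans; have /andP [_ xlt] := x01 m.
have Kx0 := K_neq0 (x01 m).
rewrite normrV ?unitfE // [leRHS]gtr0_norm ?subr_gt0 // -div1r.
by rewrite ler_pdivrMr ?normr_gt0 // K_low.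
Qed.

(** Induction on n, dividing the functional equation at y by K(x). For n = 0 one has y^k = x;
    otherwise the induction hypothesis applies to y^k, which tends to z_(n-1). *)
Lemma radial n (y x : nat -> C) :
  (forall m, 0 < x m < 1) -> x @ \oo --> (1 : C) ->
  (forall m, y m ^+ (k ^ n.+1) = x m) -> y @ \oo --> z n ->
  (fun m => K (y m) / K (x m)) @ \oo --> (contin n).1 /\
  (fun m => K (y m ^+ k) / K (x m)) @ \oo --> (contin n).2.
Proof.
move=> x01 x1; have Kx0 m := K_neq0 (x01 m).
have Ki := K_inv_cvg x01 x1.
have unit_lt (w : C) N : (0 < N)%N -> `|w ^+ N| < 1 -> `|w| < 1.
  move=> N0; rewrite normrX => wN; rewrite real_ltNge ?normr_real ?real1 //.
  by apply: contraTN wN => w1; rewrite le_gtF // exprn_ege1.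
have xn m : `|x m| < 1 by have /andP[x0 ?] := x01 m; rewrite gtr0_norm.
elim: n y => [|n IH] y yx yz.
  have yk m : y m ^+ k = x m by rewrite -yx expn1.
  have y1 m : `|y m| < 1 by apply: (unit_lt _ k); rewrite ?yk //; lia.
  split; last first.
    by under eq_fun => m do rewrite yk divff //; exact: cvgCst.
  have -> : (fun m => K (y m) / K (x m)) = (fun m => p.[y m] +
     (q.[y m] * (q.[x m] * (K (x m ^+ k) / K (x m))) - q.[y m] * (K (x m))^-1)).
    apply/funext => m; rewrite K_eq // yk; field; exact: Kx0.
  rewrite /= -[p.[z 0%N]]addr0; apply: cvgCD; first exact: cvg_horner.
  rewrite -[0]subr0; apply: cvgCB.
    (* Here q(y) tends to q(z_0) = 0, while K(x^k) / K(x) is bounded by 1 thanks to [K_mono]. *)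
    have qy : (fun m => q.[y m]) @ \oo --> (0 : C) by rewrite -z0; exact: cvg_horner.
    have -> : (fun m => q.[y m] * (q.[x m] * (K (x m ^+ k) / K (x m)))) =
       (fun m => q.[x m] * q.[y m] * (K (x m ^+ k) / K (x m))).
      by apply/funext => m; ring.
    apply: (cvg0_bounded (M := 1)); last first.
      move=> m; rewrite normrM normrV ?unitfE ?Kx0 //.
      by rewrite ler_pdivrMr ?normr_gt0 ?Kx0 // mul1r K_mono.
    rewrite -(mulr0 q.[1]); apply: cvgCM => //; exact: cvg_horner.
  rewrite -(mulr0 q.[z 0%N]); apply: cvgCM => //; exact: cvg_horner.
have y1 m : `|y m| < 1.
  by apply: (unit_lt _ (k ^ n.+2)%N); rewrite ?yx ?expn_gt0 //; lia.
have ykx m : (y m ^+ k) ^+ (k ^ n.+1) = x m by rewrite -exprM -expnS yx.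
have ykz : (fun m => y m ^+ k) @ \oo --> z n.
  rewrite -zS; under eq_fun do rewrite -[_ ^+ k]hornerXn.
  by rewrite -[_ ^+ k]hornerXn; exact: cvg_horner.
have [I1 I2] := IH _ ykx ykz; split; last exact: I1.
have -> : (fun m => K (y m) / K (x m)) = (fun m => p.[y m] * (K (y m ^+ k) / K (x m)) +
   q.[y m] * (q.[y m ^+ k] * (K ((y m ^+ k) ^+ k) / K (x m)) - (K (x m))^-1)).
  apply/funext => m; rewrite K_eq //; field; exact: Kx0.
rewrite /= -/(contin n) -mulrA -[X in q.[_] * X]subr0.
apply: cvgCD; apply: cvgCM => //; try exact: cvg_horner.
by apply: cvgCB => //; apply: cvgCM => //; exact: cvg_horner.
Qed.

Variable t : nat -> C.
Hypothesis t01 : forall m, 0 < t m < 1.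
Hypothesis t1 : t @ \oo --> (1 : C).

(** * Polynomial relations between K(z) and K(z^k) *)

Section Relation.
Variables (s : seq (nat * nat)) (b : nat * nat -> {poly C}).
Hypothesis s_uniq : uniq s.
Hypothesis rel : forall x, `|x| < 1 ->
  \sum_(m <- s) (b m).[x] * (K x ^+ m.1 * K (x ^+ k) ^+ m.2) = 0.

(** The relation at y = t z_n is divided by K(x)^d, where x = y^(k^(n+1)) tends to 1 within ]0,1[.
    Terms of total degree below d keep a factor 1/K(x), which tends to 0. *)
Lemma top_form n d :
  (forall m, m \in s -> (d < m.1 + m.2)%N -> b m = 0) ->
  \sum_(m <- s | (m.1 + m.2 == d)%N)
     (b m).[z n] * ((contin n).1 ^+ m.1 * (contin n).2 ^+ m.2) = 0.
Proof.
move=> bd; pose y m := t m * z n; pose x m := t m ^+ (k ^ n.+1).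
have kn0 : (0 < k ^ n.+1)%N by rewrite expn_gt0; lia.
have x01 m : 0 < x m < 1.
  have /andP [t0 tlt] := t01 m; rewrite exprn_gt0 //=.
  by rewrite exprn_ilt1 ?ltW // -lt0n.
have x1 : x @ \oo --> (1 : C) by rewrite -(expr1n _ (k ^ n.+1)); apply: cvg_pow.
have yx m : y m ^+ (k ^ n.+1) = x m by rewrite exprMn tower_pow1 mulr1.
have yz : y @ \oo --> z n.
  by rewrite -[z n]mul1r; apply: cvgCM => //; exact: cvgCst.
have y1 m : `|y m| < 1.
  by rewrite normrM tower_norm mulr1; have /andP [t0 ?] := t01 m; rewrite gtr0_norm.
have [L1 L2] := radial x01 x1 yx yz.
pose f (m : nat * nat) j := (b m).[y j] * ((K (y j) / K (x j)) ^+ m.1 *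
  (K (y j ^+ k) / K (x j)) ^+ m.2 * (K (x j))^-1 ^+ (d - (m.1 + m.2))).
(* The power of 0 is 1 in total degree d and 0 below. Above d the truncated subtraction makes it 1,
   but there [b m] is 0. *)
pose l (m : nat * nat) := (b m).[z n] * ((contin n).1 ^+ m.1 * (contin n).2 ^+ m.2 *
  0 ^+ (d - (m.1 + m.2))).
have fl m : f m @ \oo --> l m.
  apply: cvgCM; first exact: cvg_horner.
  apply: cvgCM; last by apply: cvg_pow; exact: K_inv_cvg.
  by apply: cvgCM; apply: cvg_pow.
have := cvg_sum_seq (r := s) fl.
have -> : (fun j => \sum_(i <- s) f i j) = (fun=> 0).
  apply/funext => j; have Kx := K_neq0 (x01 j).
  transitivity ((K (x j))^-1 ^+ d *
      \sum_(m <- s) (b m).[y j] * (K (y j) ^+ m.1 * K (y j ^+ k) ^+ m.2)).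
    rewrite mulr_sumr; apply: eq_big_seq => m ms; rewrite /f.
    have [md|dm] := leqP (m.1 + m.2) d; last by rewrite (bd _ ms dm) !horner0 !mul0r mulr0.
    rewrite -{2}(subnK md) !exprD !exprMn; ring.
  by rewrite rel // mulr0.
move/(cvgC_unique (cvg_cst (0 : C))) => l0.
rewrite [RHS]l0 big_mkcond; apply: eq_big_seq => m ms; rewrite /l.
case: ltngtP => [md|dm|->]; last by rewrite subnn expr0 mulr1.
  by rewrite expr0n subn_eq0 leqNgt md /= !mulr0.
by rewrite (bd _ ms dm) !horner0 !mul0r.
Qed.

(** By [contin_rho], the top form at z_(n+1) is the d-th power of [(contin n.+1).2] times the value
    of [Q] at (z_(n+1), [rho n]); so [vanishes_eq0] applies to [Q]. *)
Lemma top_coef_eq0 d :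
  (forall m, m \in s -> (d < m.1 + m.2)%N -> b m = 0) ->
  forall m, m \in s -> (m.1 + m.2)%N = d -> b m = 0.
Proof.
move=> bd m ms md.
pose Q : {poly {poly C}} := \sum_(m <- s | (m.1 + m.2 == d)%N) (b m * q ^+ m.1) *: 'X^(m.1).
have Q0 : Q = 0.
  apply: (@vanishes_eq0 C k hk (fun n => z n.+1) rho).
  - by move=> i j /tower_inj [].
  - by move=> n; rewrite zS.
  - exact: rho_neq0.
  - exact: rhoS.
  exists 0%N => n _; have [c0 _] := rho_spec n.
  apply: (mulIf (expf_neq0 d c0)); rewrite mul0r -[RHS](top_form n.+1 bd).
  rewrite /Q !horner_sum mulr_suml; apply: eq_bigr => j /eqP jd.
  rewrite hornerZ hornerXn !hornerM !horner_exp hornerC contin_rho -/q.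
  rewrite -jd exprD !exprMn; ring.
have := congr1 (fun U : {poly {poly C}} => U`_(m.1)) Q0.
rewrite coef0 coef_sum big_mkcond (bigD1_seq m) //= md eqxx big1 => [|j jm].
  rewrite addr0 coefZ coefXn eqxx mulr1 => /eqP.
  rewrite mulf_eq0 expf_eq0 => /orP [/eqP //|/andP [_ /eqP q0]].
  by have := tower_qk 0; rewrite q0 horner0 eqxx.
(* Two monomials of total degree d with the same first exponent coincide. *)
case: eqP => // jd; rewrite coefZ coefXn; case: eqP => [jm1|]; last by rewrite mulr0.
case/eqP: jm; move: jd md jm1; case: (j) => j1 j2; case: (m) => m1 m2 /= h1 h2 h3.
by congr (_, _); lia.
Qed.

(** Descending induction on the total degree, from a strict bound [B] valid on all of [s]. *)
Lemma relation_eq0 m : m \in s -> b m = 0.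
Proof.
pose B := (\sum_(j <- s) (j.1 + j.2)).+1.
have sB j : j \in s -> (j.1 + j.2 < B)%N.
  by move=> js; rewrite ltnS (big_rem j) //= leq_addr.
suff claim e : forall j, j \in s -> (B <= j.1 + j.2 + e)%N -> b j = 0.
  by move=> ms; apply: (claim B) => //; rewrite leq_addl.
elim: e => [|e IH] j js; first by rewrite addn0 leqNgt sB.
move=> jB; have [|jlt] := leqP B (j.1 + j.2 + e); first exact: IH.
apply: (@top_coef_eq0 (j.1 + j.2)%N) => // i si ij; apply: IH => //; lia.
Qed.

End Relation.
End Tower.

Lemma tower_exists (C : numClosedFieldType) (k : nat) : (2 <= k)%N ->
  exists2 z : nat -> C, (qk C k).[z 0%N] = 0 & forall n, z n.+1 ^+ k = z n.
Proof.
move=> hk; have [w /eqP w0] : exists w, root (qk C k) w.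
  apply/closed_rootP; have qtop := @lead_at_qk C k hk; apply/eqP => /eqP/size_poly1P [c _ qE].
  case: qtop => _; rewrite qE coefC ifF; first by move/esym/eqP; rewrite oner_eq0.
  by case: k hk {qE} => [|[]].
exists (fun n => iter n (fun x => k.-root x) w) => // n.
by rewrite /= rootCK //; lia.
Qed.

(** * The power series K *)

Section Kappa.
Variable k : nat.
Hypothesis hk : (2 <= k)%N.

Lemma digits0 : digits k 0 = [::].
Proof. by rewrite /digits up_log1. Qed.

Lemma up_log_digits m i : (i < k)%N -> (0 < k * m + i)%N ->
  up_log k (k * m + i).+1 = (up_log k m.+1).+1.
Proof.
move=> ik mi; have := up_logP m.+1 hk; set e := up_log k m.+1 => me.
apply: up_log_eq => //; apply/andP; split; last first.
  by apply: leq_trans (_ : k * m.+1 <= _)%N; [nia|rewrite expnS leq_mul2l me orbT].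
have [m0|m0] := posnP m; first by move: mi; rewrite /e m0 up_log1 expn0; lia.
have e0 : (0 < e)%N by rewrite up_log_gt0 hk.
have := up_log_gtn hk (m0 : (1 < m.+1)%N); rewrite -/e -{2}(prednK e0) expnS.
by move=> H; have : (k * k ^ e.-1 <= k * m)%N; [rewrite leq_mul2l -ltnS H orbT|lia].
Qed.

Lemma digits_step m i : (i < k)%N -> (0 < k * m + i)%N ->
  digits k (k * m + i) = i :: digits k m.
Proof.
move=> ik mi; have k0 : (0 < k)%N by lia.
rewrite /digits up_log_digits // /mkseq /= expn0 divn1 mulnC modnMDl modn_small //.
congr (_ :: _); rewrite -[1%N]addn0 iotaDl -map_comp; apply: eq_map => j /=.
by rewrite expnD expn1 divnMA divnMDl // (divn_small ik) addn0.
Qed.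

Definition digits_mx n : 'M[nat]_2 := \prod_(i <- digits k n) digit_mx i.

(* Equal to kappa (n / k) when n > 0, but to 0 when n = 0. *)
Definition kappa_tail n : nat := digits_mx n 1 0.

Lemma kappaE n : kappa k n = digits_mx n 0 0.
Proof.
by rewrite /kappa -/(digits_mx n) -rowE trmx_delta -colE !mxE.
Qed.

Lemma digits_mx0 : digits_mx 0 = 1.
Proof. by rewrite /digits_mx digits0 big_nil. Qed.

Lemma digits_mx_step m i (r : 'I_2) : (i < k)%N -> (0 < k * m + i)%N ->
  digits_mx (k * m + i) r 0 =
    (digit_mx i r 0%R * kappa k m + digit_mx i r 1%R * kappa_tail m)%N.
Proof.
move=> ik mi; rewrite kappaE /digits_mx digits_step // big_cons.
rewrite -/(digits_mx m) mxE big_ord_recl big_ord1; congr (_ * _ + _ * digits_mx m _ _)%N.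
  by congr (digit_mx i r _); apply: val_inj.
by apply: val_inj.
Qed.

Lemma kappa0 : kappa k 0 = 1%N.
Proof. by rewrite kappaE digits_mx0 mxE. Qed.

Lemma kappa_tail0 : kappa_tail 0 = 0%N.
Proof. by rewrite /kappa_tail digits_mx0 mxE. Qed.

Lemma kappa_step m i : (i < k)%N ->
  kappa k (k * m + i) = (i.+1 * kappa k m + kappa_tail m)%N.
Proof.
move=> ik; have [|mi] := posnP (k * m + i).
  move/eqP; rewrite addn_eq0 muln_eq0 => /andP [/orP [/eqP k0|/eqP ->] /eqP ->].
    by move: hk; rewrite k0.
  by rewrite muln0 kappa0 kappa_tail0.
by rewrite {1}kappaE digits_mx_step // !mxE /= mul1n.
Qed.

Lemma kappa_tail_step m i : (i < k)%N -> (0 < k * m + i)%N ->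
  kappa_tail (k * m + i) = kappa k m.
Proof.
by move=> ik mi; rewrite {1}/kappa_tail digits_mx_step // !mxE /= mul1n addn0.
Qed.

Lemma base_ind (P : nat -> Prop) : P 0%N ->
  (forall m i, (i < k)%N -> (0 < k * m + i)%N -> P m -> P (k * m + i)%N) ->
  forall n, P n.
Proof.
move=> P0 PS n; have [N] := ubnP n; elim: N n => // N IH n; rewrite ltnS => nN.
have [->//|n0] := posnP n; have k0 : (0 < k)%N by lia.
have nE : n = (k * (n %/ k) + n %% k)%N by rewrite mulnC -divn_eq.
rewrite nE; apply: PS; rewrite ?ltn_mod -?nE //; apply: IH.
by apply: leq_trans nN; rewrite ltn_Pdiv.
Qed.

Lemma kappa_gt0 n : (0 < kappa k n)%N.
Proof.
elim/base_ind: n => [|m i ik _ IH]; first by rewrite kappa0.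
by rewrite kappa_step //; nia.
Qed.

Lemma kappa_tail_le n : (kappa_tail n <= kappa k n)%N.
Proof.
elim/base_ind: n => [|m i ik mi _]; first by rewrite kappa_tail0.
by rewrite kappa_tail_step // kappa_step //; nia.
Qed.

(** A polynomial bound suffices for convergence in the unit disc. With [kappa_tail_le], the
    recursion gives (i + 2) (m + 1)^2, to be compared with (k m + i + 1)^2. *)
Lemma kappa_le n : (kappa k n <= n.+1 ^ 2)%N.
Proof.
elim/base_ind: n => [|m i ik mi IH]; first by rewrite kappa0.
rewrite kappa_step //; have tl := kappa_tail_le m.
have [m0|m0] := posnP m.
  by rewrite m0 muln0 kappa0 kappa_tail0 muln1 addn0 add0n -mulnn leq_pmull.
apply: leq_trans (_ : i.+2 * m.+1 ^ 2 <= _)%N; first by nia.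
(* For i > 0 one has i + 2 <= (i + 1)^2. This fails for i = 0, where 2 (m + 1)^2 <= (2 m + 1)^2 is
   used, valid as m >= 1. *)
have [i0|i0] := posnP i.
  rewrite i0 addn0 -!mulnn.
  have H : ((2 * m).+1 <= (k * m).+1)%N by nia.
  by apply: leq_trans (leq_mul H H); nia.
have H : (i.+1 * m.+1 <= (k * m + i).+1)%N by nia.
rewrite -[X in (_ <= X)%N]mulnn; apply: leq_trans (leq_mul H H).
by rewrite -mulnn; nia.
Qed.

Variable A : comNzRingType.

Definition Kpart N (x : A) := \sum_(n < N) (kappa k n)%:R * x ^+ n.
Definition tail_part N (x : A) := \sum_(n < N) (kappa_tail n)%:R * x ^+ n.

Lemma big_base (F : nat -> A) N :
  \sum_(n < k * N) F n = \sum_(m < N) \sum_(i < k) F (k * m + i)%N.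
Proof.
elim: N => [|N IH]; first by rewrite muln0 !big_ord0.
by rewrite big_ord_recr -IH /= mulnSr big_split_ord.
Qed.

(** With indices written k m + i, the recursion holds exactly on sums of length k N, before any
    limit. *)
Lemma Kpart_step N x : Kpart (k * N) x =
  (\sum_(i < k) i.+1%:R * x ^+ i) * Kpart N (x ^+ k) +
  (\sum_(i < k) x ^+ i) * tail_part N (x ^+ k).
Proof.
rewrite /Kpart (big_base (fun n => (kappa k n)%:R * x ^+ n)) !mulr_sumr -big_split.
apply: eq_bigr => m _ /=.
rewrite !mulr_suml -big_split; apply: eq_bigr => i _ /=.
rewrite kappa_step // natrD natrM exprD exprM; ring.
Qed.

(** The -1 corrects the index 0, where [kappa_tail] is 0 while [kappa] at 0 / k is 1; the length
    [N.+1] ensures that this index occurs. *)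
Lemma tail_part_step N x : tail_part (k * N.+1) x =
  (\sum_(i < k) x ^+ i) * Kpart N.+1 (x ^+ k) - 1.
Proof.
have -> : tail_part (k * N.+1) x =
    \sum_(n < k * N.+1) (kappa k (n %/ k))%:R * x ^+ n - 1.
  have -> : (k * N.+1 = (k * N.+1).-1.+1)%N by rewrite prednK // muln_gt0; lia.
  rewrite /tail_part !big_ord_recl /= kappa_tail0 div0n kappa0 mul0r add0r expr0 mulr1.
  rewrite [1 + _]addrC addrK; apply: eq_bigr => i _; congr (_%:R * _).
  set n := bump 0 i; have k0 : (0 < k)%N by lia.
  rewrite {1}(divn_eq n k) mulnC kappa_tail_step ?ltn_mod //.
  by rewrite mulnC -divn_eq.
rewrite (big_base (fun n => (kappa k (n %/ k))%:R * x ^+ n)) mulr_sumr.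
congr (_ - 1); apply: eq_bigr => m _; rewrite mulr_suml; apply: eq_bigr => i _.
have k0 : (0 < k)%N by lia.
rewrite mulnC divnMDl // divn_small // addn0 exprD mulnC exprM; ring.
Qed.

End Kappa.

Local Open Scope complex_scope.

(** * Convergence, functional equation and size of K in the unit disc *)

Section Series.
Variables (R : realType) (k : nat).
Hypothesis hk : (2 <= k)%N.
Local Notation C := (R[i] : numClosedFieldType).

Lemma kappa_summable (r : R) : 0 <= r < 1 ->
  cvgn (series (fun n => (kappa k n)%:R * r ^+ n)).
Proof.
(* As r = w^4, a factor (w^n)^2 absorbs (n + 1)^2 and (w^2)^n is left as a geometric majorant. *)
move=> /andP [r0 r1]; pose w := Num.sqrt (Num.sqrt r).
have w0 : 0 <= w by rewrite sqrtr_ge0.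
have w4 : w ^+ 2 ^+ 2 = r by rewrite !sqr_sqrtr ?sqrtr_ge0.
have w1 : w < 1.
  rewrite ltNge; apply/negP => w1; move: r1; rewrite -w4 -exprM ltNge.
  by rewrite exprn_ege1.
have nw n : n.+1%:R * w ^+ n <= (1 - w)^-1.
  rewrite -[leRHS]mul1r ler_pdivlMr ?subr_gt0 //.
  apply: le_trans (_ : (\sum_(i < n.+1) w ^+ i) * (1 - w) <= _).
    rewrite ler_wpM2r ?subr_ge0 ?(ltW w1) // -[n.+1]card_ord mulr_natl -sumr_const card_ord.
    by apply: ler_sum => i _; rewrite ler_wiXn2l ?(ltW w1) // -ltnS.
  have -> : (\sum_(i < n.+1) w ^+ i) * (1 - w) = 1 - w ^+ n.+1.
    by rewrite -[RHS]opprB subrX1 -mulNr opprB mulrC.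
  by rewrite lerBlDr lerDl exprn_ge0.
have w2 : `|w ^+ 2| < 1 by rewrite ger0_norm ?exprn_ge0 // exprn_ilt1.
apply: (series_le_cvg _ _ _ (is_cvg_geometric_series (a := (1 - w)^-1 ^+ 2) w2)) => n.
- by rewrite mulr_ge0 ?ler0n ?exprn_ge0.
- by rewrite /geometric /= mulr_ge0 ?exprn_ge0 ?invr_ge0 ?subr_ge0 ?(ltW w1).
rewrite /geometric /= -{1}w4.
apply: le_trans (_ : (n.+1%:R * w ^+ n) ^+ 2 * w ^+ 2 ^+ n <= _); last first.
  rewrite ler_wpM2r ?exprn_ge0 // lerXn2r ?nnegrE ?mulr_ge0 ?exprn_ge0 ?ler0n //.
  by rewrite invr_ge0 subr_ge0 ltW.
have -> : w ^+ 2 ^+ 2 ^+ n = (w ^+ n) ^+ 2 * w ^+ 2 ^+ n.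
  by rewrite -!exprM -exprD; congr (_ ^+ _); lia.
rewrite [(_%:R * _) ^+ 2]exprMn [leLHS]mulrA.
apply: ler_wpM2r; first by rewrite exprn_ge0 ?exprn_ge0.
apply: ler_wpM2r; first by rewrite !exprn_ge0.
by rewrite -natrX ler_nat kappa_le.
Qed.

Lemma norm_real_complex (x : R) : `|x%:C| = `|x|%:C.
Proof. by rewrite normc_def /= expr0n addr0 sqrtr_sqr. Qed.

Lemma norm_complexE (z : R[i]) : `|z| = (complex.Re `|z|)%:C.
Proof. by rewrite normc_def. Qed.

Lemma cvg_real_complex (u : nat -> R) (a : R) :
  u @ \oo --> a -> (fun n => (u n)%:C : C) @ \oo --> (a%:C : C).
Proof.
move=> /cvgrPdist_le ua; apply/(cvgrPdist_le (V := C^o)) => e.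
rewrite ltcE /= => /andP [/eqP ei er].
apply: filterS (ua _ er) => n un; rewrite -raddfB /= norm_real_complex lecE /= ei eqxx.
exact: un.
Qed.

Lemma Re_le_norm (z : R[i]) : `|complex.Re z| <= complex.Re `|z|.
Proof. by rewrite -lecR -norm_complexE normc_ge_Re. Qed.

Lemma Im_le_norm (z : R[i]) : `|complex.Im z| <= complex.Re `|z|.
Proof.
rewrite normc_def /= -sqrtr_sqr ler_sqrt ?lerDr ?sqr_ge0 //.
by rewrite addr_ge0 ?sqr_ge0.
Qed.

(** Intended for [f] the real or the imaginary part: convergence in [R[i]] reduces to comparison
    with the real series at |z|. *)
Lemma series_kappa_bounded (z : R[i]) (f : R[i] -> R) : `|z| < 1 ->
  (forall x, `|f x| <= complex.Re `|x|) ->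
  cvgn (series (fun n => (kappa k n)%:R * f (z ^+ n))).
Proof.
move=> z1 fb; apply: normed_cvg.
have r01 : 0 <= complex.Re `|z| < 1.
  by rewrite -!lecR -ltcR -norm_complexE normr_ge0 z1.
apply: (series_le_cvg _ _ _ (kappa_summable r01)) => n.
- exact: normr_ge0.
- by rewrite mulr_ge0 ?ler0n ?exprn_ge0 //; case/andP: r01.
rewrite /= normrM ger0_norm ?ler0n // ler_wpM2l ?ler0n //.
apply: le_trans (fb _) _; rewrite -lecR -norm_complexE normrX rmorphXn /=.
by rewrite -norm_complexE.
Qed.

Lemma Kpart_cvg (z : R[i]) : `|z| < 1 ->
  (fun N => Kpart k N z : C) @ \oo --> (K R k z : C).
Proof.
move=> z1; have /cvg_ex [a /= ra] := series_kappa_bounded z1 Re_le_norm.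
have /cvg_ex [b /= rb] := series_kappa_bounded z1 Im_le_norm.
have L : (fun N => Kpart k N z : C) @ \oo --> (a%:C + 'i%C * b%:C : C).
  have := cvgCD (cvg_real_complex ra) (cvgCM (cvgCst (a := ('i%C : C))) (cvg_real_complex rb)).
  apply: cvg_ext => N; rewrite /Kpart /series /= !big_mkord !rmorph_sum mulr_sumr -big_split.
  apply: eq_bigr => i _ /=; rewrite !rmorphM !rmorph_nat [X in _ = _ * X]complexE.
  by rewrite mulrDr [in RHS]mulrCA.
suff -> : K R k z = a%:C + 'i%C * b%:C by [].
rewrite /K; apply: (cvg_lim (@norm_hausdorff _ (R[i])^o)).
have -> : series (fun n => (kappa k n)%:R * z ^+ n : R[i]^o) = (fun N => Kpart k N z).
  by apply/funext => N; rewrite /series /= big_mkord.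
exact: L.
Qed.

(** Partial sums of length k (k (N + 1)) satisfy the equation exactly, by [Kpart_step] and
    [tail_part_step]; the limits are taken along subsequences. *)
Lemma K_functional (z : R[i]) : `|z| < 1 ->
  K R k z = (pk C k).[z] * K R k (z ^+ k) +
    (qk C k).[z] * ((qk C k).[z ^+ k] * K R k ((z ^+ k) ^+ k) - 1).
Proof.
move=> z1; have k0 : k != 0%N by lia.
have zk1 : `|z ^+ k| < 1 by rewrite normrX exprn_ilt1.
have zkk1 : `|(z ^+ k) ^+ k| < 1 by rewrite normrX exprn_ilt1.
have L1 : (fun N => Kpart k (k * (k * N.+1)) z : C) @ \oo --> (K R k z : C).
  apply: (cvg_sub (u := fun N => Kpart k N z : C)); last exact: Kpart_cvg.
  by move=> n; nia.
have L2 : (fun N => Kpart k (k * N.+1) (z ^+ k) : C) @ \oo --> (K R k (z ^+ k) : C).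
  apply: (cvg_sub (u := fun N => Kpart k N (z ^+ k) : C)); last exact: Kpart_cvg.
  by move=> n; nia.
have L3 : (fun N => Kpart k N.+1 ((z ^+ k) ^+ k) : C) @ \oo --> (K R k ((z ^+ k) ^+ k) : C).
  by apply: (cvg_sub (u := fun N => Kpart k N ((z ^+ k) ^+ k) : C)); last exact: Kpart_cvg.
apply: (cvgC_unique (C := C) L1).
have -> : (fun N => Kpart k (k * (k * N.+1)) z : C) = (fun N =>
   (pk C k).[z] * Kpart k (k * N.+1) (z ^+ k) +
    (qk C k).[z] * ((qk C k).[z ^+ k] * Kpart k N.+1 ((z ^+ k) ^+ k) - 1)).
  by apply/funext => N; rewrite (Kpart_step hk) (tail_part_step hk) horner_pk !horner_qk.
apply: (cvgCD (C := C)); apply: (cvgCM (C := C)); try exact: (cvgCst (C := C)); first exact: L2.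
apply: (cvgCB (C := C)); last exact: (cvgCst (C := C)).
by apply: (cvgCM (C := C)); [exact: (cvgCst (C := C))|exact: L3].
Qed.

Definition Kreal (r : R) : R := limn (series (fun n => (kappa k n)%:R * r ^+ n)).

Lemma Kreal_cvg r : 0 <= r < 1 -> (fun N => Kpart k N r) @ \oo --> Kreal r.
Proof.
move=> r01; have -> : (fun N => Kpart k N r) = series (fun n => (kappa k n)%:R * r ^+ n).
  by apply/funext => N; rewrite /series /= big_mkord.
exact: kappa_summable.
Qed.

Lemma K_real r : 0 <= r < 1 -> K R k r%:C = (Kreal r)%:C.
Proof.
move=> r01; have /andP [r0 r1] := r01.
have L : (fun N => Kpart k N r%:C : C) @ \oo --> (K R k r%:C : C).
  by apply: Kpart_cvg; rewrite norm_real_complex ger0_norm // ltcR.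
apply: (cvgC_unique (C := C) L).
have -> : (fun N => Kpart k N r%:C : C) = (fun N => (Kpart k N r)%:C : C).
  apply/funext => N; rewrite /Kpart rmorph_sum; apply: eq_bigr => i _.
  by rewrite rmorphM rmorph_nat rmorphXn.
exact/cvg_real_complex/Kreal_cvg.
Qed.

(** Every [kappa] is at least 1, so the partial sums dominate the geometric ones. *)
Lemma Kreal_low r : 0 <= r < 1 -> 1 <= (1 - r) * Kreal r.
Proof.
move=> r01; have /andP [r0 r1] := r01.
have r1' : `|r| < 1 by rewrite ger0_norm.
have L : (fun N => 1 - r ^+ N) @ \oo --> (1 - 0 : R).
  by apply: cvgB; [exact: cvg_cst|exact: cvg_expr].
rewrite subr0 in L; apply: (ler_cvg_to L (g := fun N => (1 - r) * Kpart k N r)).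
  by apply: cvgM; [exact: cvg_cst|exact: Kreal_cvg].
near=> N.
have -> : 1 - r ^+ N = (1 - r) * \sum_(n < N) r ^+ n.
  by rewrite -[RHS]opprK -mulNr opprB -subrX1 opprB.
rewrite ler_wpM2l ?subr_ge0 ?(ltW r1) //; apply: ler_sum => i _.
by rewrite ler_peMl ?exprn_ge0 // ler1n kappa_gt0.
Unshelve. all: by end_near.
Qed.

Lemma Kreal_mono r s : 0 <= r -> r <= s -> s < 1 -> Kreal r <= Kreal s.
Proof.
move=> r0 rs s1; have s0 := le_trans r0 rs; have r1 := le_lt_trans rs s1.
apply: ler_cvg_to (Kreal_cvg _) (Kreal_cvg _) _; rewrite ?r0 ?s0 //.
near=> N; apply: ler_sum => i _; rewrite ler_wpM2l ?ler0n //.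
by rewrite lerXn2r.
Unshelve. all: by end_near.
Qed.

Lemma unit_real (x : R[i]) : 0 < x < 1 -> exists2 r : R, 0 < r < 1 & x = r%:C.
Proof.
move=> /andP [x0 x1]; have /complex_realP [r xr] := ger0_real (ltW x0).
by exists r => //; rewrite -!ltcR -xr x0.
Qed.

Lemma K_low_bound (x : R[i]) : 0 < x < 1 -> 1 <= (1 - x) * `|K R k x|.
Proof.
move=> /unit_real [r /andP [r0 r1] ->]; have r01 : 0 <= r < 1 by rewrite (ltW r0).
rewrite K_real // norm_real_complex -(rmorph1 (real_complex R)) -rmorphB -rmorphM /= lecR.
apply: le_trans (Kreal_low r01) _; rewrite ler_wpM2l ?ler_norm //.
by rewrite subr_ge0 ltW.
Qed.

Lemma K_le_pow (x : R[i]) : 0 < x < 1 -> `|K R k (x ^+ k)| <= `|K R k x|.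
Proof.
move=> /unit_real [r /andP [r0 r1] ->]; have r01 : 0 <= r < 1 by rewrite (ltW r0).
have rk0 : 0 <= r ^+ k by rewrite exprn_ge0 ?ltW.
have rkr : r ^+ k <= r by rewrite ler_iXnr ?(ltW r0) ?(ltW r1) //; lia.
have rk1 : 0 <= r ^+ k < 1 by rewrite rk0 (le_lt_trans rkr).
have pos s : 0 <= s < 1 -> 0 <= Kreal s.
  move=> s01; have := Kreal_low s01; have /andP [_ s1] := s01.
  by move/(lt_le_trans ltr01); rewrite pmulr_rgt0 ?subr_gt0 // => /ltW.
rewrite -rmorphXn /= !K_real // !norm_real_complex lecR !ger0_norm ?pos //.
by apply: Kreal_mono.
Qed.

Lemma unit_seq_exists : exists2 t : nat -> C, (forall m, 0 < t m < 1) & t @ \oo --> (1 : C).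
Proof.
(* The shift avoids [harmonic 0] = 1, which would give the value 0. *)
exists (fun m => (1 - harmonic m.+1)%:C).
  move=> m; rewrite -(rmorph0 (real_complex R)) -(rmorph1 (real_complex R)) !ltcR.
  rewrite /harmonic /= subr_gt0 ltrBlDr ltrDl invr_gt0 ltr0n andbT.
  by rewrite invf_lt1 ?ltr0n // ltr1n.
have -> : (1 : C) = (1 - 0 : R)%:C by rewrite subr0.
apply: cvg_real_complex; apply: cvgB; first exact: cvg_cst.
apply: (cvg_sub (u := harmonic : R ^nat) (phi := succn)) => //; exact: cvg_harmonic.
Qed.

End Series.

Local Close Scope complex_scope.

(** * Rational functions *)

Section FieldFractions.
Variables (A : idomainType) (F : fieldType) (iota : {rmorphism A -> F}).
Hypothesis iota_inj : injective iota.

Lemma iota_neq0 a : a != 0 -> iota a != 0.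
Proof. by apply: contraNneq => e; apply/eqP/iota_inj; rewrite rmorph0. Qed.

Lemma div_iota_eq p q p' q' : q != 0 -> q' != 0 ->
  iota p / iota q = iota p' / iota q' -> p * q' = p' * q.
Proof.
move=> /iota_neq0 q0 /iota_neq0 q0' /eqP; rewrite eqr_div // -!rmorphM.
by move/eqP/iota_inj.
Qed.

Lemma common_denominator (r : seq F) :
  (forall g, g \in r -> exists p q, q != 0 /\ g = iota p / iota q) ->
  exists2 D, D != 0 & forall g, g \in r -> exists N, g = iota N / iota D.
Proof.
elim: r => [_|g r IH rP]; first by exists 1; rewrite ?oner_neq0.
have [h hr|D D0 DP] := IH; first by apply: rP; rewrite inE hr orbT.
have [p [q [q0 ->]]] := rP g (mem_head _ _).
exists (D * q) => [|h]; first by rewrite mulf_neq0.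
rewrite inE => /orP [/eqP ->|/DP [N ->]].
  by exists (D * p); rewrite !rmorphM -mulf_div divff ?iota_neq0 // mul1r.
by exists (N * q); rewrite !rmorphM -mulf_div divff ?iota_neq0 // mulr1.
Qed.

Lemma eq_div_iota p q g : q != 0 -> iota q * g = iota p -> g = iota p / iota q.
Proof. by move=> /iota_neq0 q0 <-; rewrite mulrAC divff // mul1r. Qed.

End FieldFractions.

Section RatFun.
Variable C : fieldType.
Let iota : {rmorphism {poly C} -> ratfun C} := @tofrac {poly C}.

Lemma tofrac_inj : injective iota.
Proof. by move=> p q /eqP; rewrite /iota tofrac_eq => /eqP. Qed.

Lemma ratfun_frac (g : ratfun C) :
  exists p q : {poly C}, q != 0 /\ g = tofrac p / tofrac q.
Proof.
elim/quotW: g => x; exists (frac x).1, (frac x).2; split; first exact: denom_ratioP.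
apply: (eq_div_iota tofrac_inj); first exact: denom_ratioP.
rewrite /iota /=; unlock FracField.tofrac; rewrite -[LHS]FracField.pi_mul.
apply/eqmodP; rewrite /= FracField.equivfE /FracField.mulf.
by rewrite !numden_Ratio ?mulf_neq0 ?oner_neq0 ?denom_ratioP // mulr1 mul1r.
Qed.

Lemma has_value_unique (g : ratfun C) (z v w : C) :
  has_value g z v -> has_value g z w -> v = w.
Proof.
move=> [p [q [qz -> ->]]] [p' [q' [qz' e ->]]].
have nz (f : {poly C}) : f.[z] != 0 -> f != 0.
  by apply: contraNneq => ->; rewrite horner0.
apply/eqP; rewrite eqr_div // -!hornerM; apply/eqP; congr (_.[z]).
exact: (div_iota_eq tofrac_inj (nz _ qz) (nz _ qz') e).
Qed.

Lemma ratfun_evalE (z : C) (p q : {poly C}) : q.[z] != 0 ->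
  ratfun_eval z (tofrac p / tofrac q) = p.[z] / q.[z].
Proof.
move=> qz; have hv : has_value (tofrac p / tofrac q) z (p.[z] / q.[z]).
  by exists p, q.
exact: has_value_unique (xgetPex 0 (ex_intro _ _ hv)) hv.
Qed.

Lemma ratfun_common_denominator (r : seq (ratfun C)) :
  exists2 D : {poly C}, D != 0 & forall g, g \in r -> exists N, g = tofrac N / tofrac D.
Proof. by apply: (common_denominator tofrac_inj) => g _; apply: ratfun_frac. Qed.

End RatFun.

(** * Clearing denominators in an algebraic relation *)

Lemma alg_independent2 (C : fieldType) (U : set C) (f : 'I_2 -> C -> C) :
  (forall (s : seq (nat * nat)) (b : nat * nat -> {poly C}), uniq s ->
    (forall x, U x ->
      \sum_(m <- s) (b m).[x] * (f ord0 x ^+ m.1 * f ord_max x ^+ m.2) = 0) ->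
    forall m, m \in s -> b m = 0) ->
  alg_independent U f.
Proof.
move=> indep P HP.
have [D D0 DP] := ratfun_common_denominator (map (fun m => mcoeff m P) (msupp P)).
have /choice [N NP] m : exists N : {poly C}, mcoeff m P = tofrac N / tofrac D.
  have [mP|mP] := boolP (m \in msupp P).
    by apply: DP; apply/mapP; exists m.
  by exists 0; rewrite tofrac0 mul0r memN_msupp_eq0.
pose mk (p : nat * nat) : multinom 2 := Multinom [tuple p.1; p.2].
pose un (m : multinom 2) := (m ord0, m ord_max).
have unK : cancel un mk.
  move=> m; apply/mnmP => i; rewrite multinomE (tnth_nth 0%N).
  by case: i => -[|[|i]] //= hi; congr (m _); apply: val_inj.
(* The extra factor [D] makes the relation hold also at the zeros of [D], where coefficients of [P]
   may have poles and [HP] says nothing. *)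
have main p : p \in map un (msupp P) -> D * N (mk p) = 0.
  apply: (indep _ (fun p => D * N (mk p))).
    by rewrite map_inj_uniq ?msupp_uniq //; apply: can_inj unK.
  move=> x xU; rewrite big_map.
  have [Dx|Dx] := eqVneq D.[x] 0.
    by apply: big1 => m _; rewrite hornerM Dx !mul0r.
  (* The square appears because D N is D^2 times the coefficient N / D. *)
  transitivity (D.[x] ^+ 2 * eval_at P f x).
    rewrite /eval_at /mmap mulr_sumr; apply: eq_bigr => m _.
    rewrite unK NP ratfun_evalE // hornerM /mmap1 big_ord_recl big_ord1.
    rewrite (_ : lift ord0 ord0 = ord_max); last exact: val_inj.
    by rewrite /un /=; field.
  rewrite HP ?mulr0 // => m; rewrite NP.
  by exists ((N m).[x] / D.[x]), (N m), D.
apply/mpolyP => m; rewrite mcoeff0; have [mP|/memN_msupp_eq0 //] := boolP (m \in msupp P).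
have := main (un m) (map_f un mP); rewrite unK => /eqP.
by rewrite mulf_eq0 (negbTE D0) NP => /eqP ->; rewrite tofrac0 mul0r.
Qed.

Theorem theorem5 (R : realType) (k : nat) (hk : (2 <= k)%N) :
  alg_independent (unit_disc R)
    (tnth [tuple K R k; fun z : R[i] => K R k (z ^+ k)%R]).
Proof.
apply: alg_independent2 => s b s_uniq rel.
have [z z0 zS] := @tower_exists (R[i] : numClosedFieldType) k hk.
have [t t01 t1] := unit_seq_exists R.
apply: (@relation_eq0 (R[i] : numClosedFieldType) k hk z z0 zS (K R k) _ _ _ t t01 t1 s b s_uniq).
- exact: K_functional.
- exact: K_le_pow.
- exact: K_low_bound.
- exact: rel.
Qed.
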